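(* Let $\beta\in(1,\frac{1+\sqrt5}{2})$. Then there exists $c=c(\beta)>0$ such that the following holds. If $f:\mathbb{N}\to(0,\infty)$ is a strictly increasing function which satisfies $$\limsup_{n\to\infty}\big(f(n+1)-f(n)\big)<c\quad\text{and}\quad \lim_{n\to\infty}f(n)=\infty,$$ then for every $x\in(-\frac{1}{\beta-1},\frac{1}{\beta-1})$ there exists $(\epsilon_i)_{i\ge1}\in\{-1,1\}^{\mathbb{N}}$ such that $$x=\sum_{i=1}^{\infty}\frac{\epsilon_i}{\beta^i}\quad\text{and}\quad x=\lim_{n\to\infty}\frac{1}{f(n)}\sum_{i=1}^{n}\epsilon_i.$$
   Context: $\mathbb{N}=\{1,2,3,\ldots\}$. *)

(* Defs.v *)
From Stdlib Require Import Reals.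
From Coquelicot Require Import Coquelicot.

(* Main.v *)
Require Import Defs.
From Stdlib Require Import Reals.
From Coquelicot Require Import Coquelicot.
From Stdlib Require Import Lra Lia.
Open Scope R_scope.

(** Digits [e] in {-1, 1} for [x] are produced by an orbit
    [y_0 = x], [y_(n+1) = beta * y_n - e_(n+1)]: as long as the orbit stays
    bounded, [x] is the sum of the series, because the error after [n] digits
    is [y_n / beta ^ n].  The remaining freedom is used to steer the digit sums
    [S_n] along [x * f n].

    Threshold digits: choose 1 when [y >= t] and -1 when [y < t].  The
    period-two orbit with digits alternating -1, 1 consists of the points
    [- 1 / (beta + 1)] and [1 / (beta + 1)]; the hypothesis on [beta] says
    exactly that [1 / (beta + 1)] is interior to the region where both digits
    keep the orbit bounded, so [t] can be taken a little above
    [1 / (beta + 1)] ([threshold_exists]).  Then, once the orbit has left the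
    neighbourhood of the left end point, two digits -1 never occur in a row,
    and an alternating stretch -1, 1, -1, 1, ... cannot last, as the orbit is
    repelled from the period-two orbit at rate [beta ^ 2].  Hence the digit
    sums grow linearly.  This is made quantitative by a bounded function [V] on
    the orbit such that [S_n + V (y_n)] increases by at least
    [drift beta t > 0] at each step ([potential_drift]); the drift depends on
    [beta] only, although [V] also depends on [x].  Mirroring everything at 0
    gives digits whose sums decrease linearly.

    Feedback: use the upward digits while [S_n < x * f n] and the downward ones
    otherwise.  If the increments of [f] are eventually below
    [drift * (beta - 1)], those of [x * f n] are smaller than the drift, so
    [S_n - x * f n] is always pushed back towards 0 and stays bounded
    ([bounded_below_by_feedback], applied on both sides).  Dividing by [f n],
    which tends to infinity, gives the limit. *)

(** * Threshold digits and their drift *)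

Definition threshold_digit (t y : R) : R := if Rlt_dec y t then -1 else 1.

Definition drift (beta t : R) : R := (beta - 1) * (t - 1 / (beta + 1)) / beta.

(** Three regimes.  In the middle and upper ones the linear part is the
    displacement from that point of the period-two orbit which gets the same
    digit, a displacement multiplied by [beta] whenever the digit changes; the
    extra 1 in the upper regime cancels the alternation of the digits.  Below
    [(t - 1) / beta] the next digit is -1 again; there the slope is so large
    that on [-M, M] the repulsion from the left end point
    [- 1 / (beta - 1)] outweighs the digits -1, and the summand -2 pays for the
    step into the middle regime. *)
Definition potential (beta t M y : R) : R :=
  if Rlt_dec y ((t - 1) / beta) then
    2 / (1 - (beta - 1) * M) * (y - (t - 1) / beta) - 2
  else if Rlt_dec y t then y + 1 / (beta + 1)
  else y - 1 / (beta + 1) + 1.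

Lemma threshold_digit_pm1 (t y : R) :
  threshold_digit t y = -1 \/ threshold_digit t y = 1.
Proof. unfold threshold_digit; destruct (Rlt_dec y t); auto. Qed.

(** [beta * beta < beta + 1] puts the upper point of the period-two orbit
    inside the region where both digits are admissible. *)
Lemma threshold_exists (beta : R) :
  1 < beta < (1 + sqrt 5) / 2 ->
  exists t, 1 / (beta + 1) < t /\ (beta - 1) * (beta * t + 1) < 1.
Proof.
  intros [h1 h2].
  assert (hq : beta * beta < beta + 1).
  { assert (h5 : sqrt 5 * sqrt 5 = 5) by (apply sqrt_sqrt; lra).
    assert (0 <= sqrt 5) by apply sqrt_pos. nra. }
  assert (hu : (beta + 1) * (1 / (beta + 1)) = 1) by (field; lra).
  set (u := 1 / (beta + 1)) in *.
  assert (hv : (beta - 1) * (beta * ((1 / (beta - 1) - 1) / beta) + 1) = 1)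
    by (field; lra).
  set (v := (1 / (beta - 1) - 1) / beta) in *.
  assert (huv : (beta - 1) * (beta * u + 1) < 1).
  { apply Rmult_lt_reg_l with (beta + 1); [lra|].
    replace ((beta + 1) * ((beta - 1) * (beta * u + 1)))
      with ((beta - 1) * (beta * ((beta + 1) * u) + (beta + 1))) by ring.
    rewrite hu. nra. }
  assert (hb : 0 < (beta - 1) * beta) by nra.
  assert (u < v) by nra.
  exists ((u + v) / 2). split; nra.
Qed.

(** [beta * t + 1] bounds the images of the points below [t]; the other points
    that could leave [-M, M] are moved towards 0 because [1 / (beta - 1)] is the
    fixed point of [y -> beta * y - 1] and repels. *)
Lemma threshold_orbit_bounded (beta t M y : R) :
  1 < beta -> 0 <= t -> beta * t + 1 <= M -> (beta - 1) * M <= 1 ->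
  Rabs y <= M -> Rabs (beta * y - threshold_digit t y) <= M.
Proof.
  intros hb ht htM hM hy.
  apply Rabs_le_between in hy. apply Rabs_le_between.
  unfold threshold_digit; destruct (Rlt_dec y t); split; nra.
Qed.

(** Below [(t - 1) / beta] the gain is at least 1; at two digits 1 in a row it is
    [(beta - 1) * y]; at a change of digit it is [beta - 1] times the
    displacement from the period-two orbit, which is smallest at
    [y = (t - 1) / beta], where it equals the drift.  An orbit point outside the
    lowest regime never returns to it, since [t > 1 / (beta + 1)]. *)
Lemma potential_drift (beta t M y : R) :
  1 < beta -> 1 / (beta + 1) < t -> (beta - 1) * (beta * t + 1) < 1 ->
  (beta - 1) * M < 1 -> Rabs y <= M ->
  drift beta t <=
    threshold_digit t y
    + potential beta t M (beta * y - threshold_digit t y)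
    - potential beta t M y.
Proof.
  intros hb ht htJ hM hy.
  apply Rabs_le_between in hy.
  assert (hu : (beta + 1) * (1 / (beta + 1)) = 1) by (field; lra).
  assert (hu0 : 0 < 1 / (beta + 1)) by (apply Rdiv_lt_0_compat; lra).
  assert (hr : beta * ((t - 1) / beta) = t - 1) by (field; lra).
  assert (hA : 2 / (1 - (beta - 1) * M) * (1 - (beta - 1) * M) = 2)
    by (field; lra).
  assert (hA0 : 0 < 2 / (1 - (beta - 1) * M))
    by (apply Rdiv_lt_0_compat; lra).
  assert (hd : beta * drift beta t = (beta - 1) * (t - 1 / (beta + 1)))
    by (unfold drift; field; lra).
  unfold potential, threshold_digit.
  set (u := 1 / (beta + 1)) in *.
  set (r := (t - 1) / beta) in *.
  set (A := 2 / (1 - (beta - 1) * M)) in *.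
  set (d := drift beta t) in *.
  assert (hur : 0 < r + u) by nra.
  assert (hru : beta * (r + u) = t - u) by nra.
  assert (hd' : d = (beta - 1) * (r + u)) by nra.
  assert (hd1 : d <= (beta - 1) * (t - u)) by nra.
  assert (hd2 : d <= 1) by nra.
  assert (hrt : r < t) by nra.
  destruct (Rlt_dec y t) as [hyt|hyt];
    [destruct (Rlt_dec y r) as [hyr|hyr]|destruct (Rlt_dec y r) as [hyr|hyr]].
  - destruct (Rlt_dec (beta * y - -1) r) as [h|h].
    + assert (A * (1 - (beta - 1) * M) <= A * ((beta - 1) * y + 1))
        by (apply Rmult_le_compat_l; nra).
      nra.
    + destruct (Rlt_dec (beta * y - -1) t) as [h'|h']; [|exfalso; nra].
      assert (A * (y - r) <= 0) by nra. nra.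
  - destruct (Rlt_dec (beta * y - -1) r) as [h|h]; [exfalso; nra|].
    destruct (Rlt_dec (beta * y - -1) t) as [h'|h']; [exfalso; nra|].
    nra.
  - exfalso; lra.
  - assert (hut : t - u <= beta * (t - u)) by nra.
    assert (hyt1 : (beta - 1) * t <= (beta - 1) * y)
      by (apply Rmult_le_compat_l; lra).
    assert (hut0 : 0 <= (beta - 1) * u) by (apply Rmult_le_pos; lra).
    assert (r + u <= t - u) by nra.
    destruct (Rlt_dec (beta * y - 1) r) as [h|h]; [exfalso; lra|].
    destruct (Rlt_dec (beta * y - 1) t) as [h'|h']; lra.
Qed.

Lemma potential_bounded (beta t M : R) :
  1 < beta -> (beta - 1) * M < 1 ->
  exists B, forall y, Rabs y <= M -> Rabs (potential beta t M y) <= B.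
Proof.
  intros hb hM.
  assert (hu0 : 0 < 1 / (beta + 1)) by (apply Rdiv_lt_0_compat; lra).
  assert (hu1 : 1 / (beta + 1) < 1)
    by (apply Rmult_lt_reg_l with (beta + 1); [lra|]; field_simplify; lra).
  assert (hA0 : 0 < 2 / (1 - (beta - 1) * M))
    by (apply Rdiv_lt_0_compat; lra).
  unfold potential.
  set (u := 1 / (beta + 1)) in *.
  set (r := (t - 1) / beta) in *.
  set (A := 2 / (1 - (beta - 1) * M)) in *.
  exists (A * (M + Rabs r) + 2 + M).
  intros y hy.
  assert (hM0 : 0 <= M) by (pose proof (Rabs_pos y); lra).
  assert (0 <= A * (M + Rabs r)) by (pose proof (Rabs_pos r); nra).
  apply Rabs_le_between in hy. apply Rabs_le_between.
  assert (hr1 : r <= Rabs r) by apply Rle_abs.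
  destruct (Rlt_dec y r); [|destruct (Rlt_dec y t); lra].
  assert (A * (- (M + Rabs r)) <= A * (y - r))
    by (apply Rmult_le_compat_l; lra).
  assert (A * (y - r) <= 0) by nra.
  lra.
Qed.

(** * Feedback *)

(** While [D] is negative, [D + p] does not decrease, and [D] enters the
    negative half-line only by a jump of at most [J]; so it cannot get far
    below 0. *)
Lemma bounded_below_by_feedback (D p : nat -> R) (B J : R) (N : nat) :
  (forall n, Rabs (p n) <= B) ->
  (forall n, (N <= n)%nat -> D n < 0 -> D n + p n <= D (S n) + p (S n)) ->
  (forall n, (N <= n)%nat -> D n - J <= D (S n)) ->
  exists C, forall n, (N <= n)%nat -> - C <= D n.
Proof.
  intros hp hup hjump.
  assert (hB : 0 <= B) by (pose proof (hp O); pose proof (Rabs_pos (p O)); lra).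
  set (C := Rmax (B + J) (B + Rabs (D N))).
  assert (hC1 : B + J <= C) by apply Rmax_l.
  assert (hC2 : B + Rabs (D N) <= C) by apply Rmax_r.
  assert (inv : forall k, 0 <= D (N + k)%nat
                          \/ - C <= D (N + k)%nat + p (N + k)%nat).
  { induction k as [|k IH].
    - rewrite Nat.add_0_r. right.
      pose proof (hp N) as h. apply Rabs_le_between in h.
      pose proof (Rle_abs (- D N)) as h'. rewrite Rabs_Ropp in h'. lra.
    - rewrite Nat.add_succ_r. right.
      pose proof (hp (S (N + k))) as h. apply Rabs_le_between in h.
      pose proof (hjump (N + k)%nat ltac:(lia)).
      pose proof (hup (N + k)%nat ltac:(lia)).
      destruct (Rlt_dec (D (N + k)%nat) 0) as [hn|hn]; [|lra].
      destruct IH; [lra|]. specialize (H0 hn). lra. }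
  exists (C + B). intros n hn.
  replace n with (N + (n - N))%nat by lia.
  pose proof (hp (N + (n - N))%nat) as h. apply Rabs_le_between in h.
  pose proof (Rabs_pos (D N)).
  destruct (inv (n - N)%nat); lra.
Qed.

Definition steering_digit (t y d : R) : R :=
  if Rlt_dec d 0 then threshold_digit t y else - threshold_digit t (- y).

(** The orbit point together with the sum of the digits used so far, when the
    digit sums are to follow [g]. *)
Fixpoint steer (beta t : R) (g : nat -> R) (x : R) (n : nat) : R * R :=
  match n with
  | O => (x, 0)
  | S k =>
      let (y, s) := steer beta t g x k in
      let e := steering_digit t y (s - g k) in
      (beta * y - e, s + e)
  end.

Definition steered_orbit beta t g x n : R := fst (steer beta t g x n).

Definition steered_sum beta t g x n : R := snd (steer beta t g x n).

(** Digits are numbered from 1; the value at 0 is a filler. *)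
Definition steered_digits beta t g x (n : nat) : R :=
  match n with
  | O => 0
  | S k =>
      steering_digit t (steered_orbit beta t g x k)
        (steered_sum beta t g x k - g k)
  end.

Lemma steering_digit_pm1 (t y d : R) :
  steering_digit t y d = -1 \/ steering_digit t y d = 1.
Proof.
  unfold steering_digit.
  destruct (Rlt_dec d 0); [apply threshold_digit_pm1|].
  destruct (threshold_digit_pm1 t (- y)); lra.
Qed.

Lemma steered_orbit_S beta t g x n :
  steered_orbit beta t g x (S n) =
  beta * steered_orbit beta t g x n - steered_digits beta t g x (S n).
Proof.
  unfold steered_digits, steered_orbit, steered_sum; simpl.
  destruct (steer beta t g x n); reflexivity.
Qed.

Lemma steered_sum_S beta t g x n :
  steered_sum beta t g x (S n) =
  steered_sum beta t g x n + steered_digits beta t g x (S n).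
Proof.
  unfold steered_digits, steered_orbit, steered_sum; simpl.
  destruct (steer beta t g x n); reflexivity.
Qed.

Lemma steered_sum_eq beta t g x n :
  sum_n_m (steered_digits beta t g x) 1 n = steered_sum beta t g x n.
Proof.
  induction n as [|n IH].
  - rewrite sum_n_m_zero; [reflexivity|lia].
  - rewrite sum_n_Sm by lia. rewrite IH, steered_sum_S. reflexivity.
Qed.

Lemma steered_orbit_bounded beta t g x M n :
  1 < beta -> 0 <= t -> beta * t + 1 <= M -> (beta - 1) * M <= 1 ->
  Rabs x <= M -> Rabs (steered_orbit beta t g x n) <= M.
Proof.
  intros hb ht htM hM hx.
  induction n as [|n IH]; [exact hx|].
  rewrite steered_orbit_S; simpl; unfold steering_digit.
  set (y := steered_orbit beta t g x n) in *.
  destruct (Rlt_dec _ 0).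
  - apply threshold_orbit_bounded; assumption.
  - rewrite <- Rabs_Ropp.
    replace (- (beta * y - - threshold_digit t (- y)))
      with (beta * (- y) - threshold_digit t (- y)) by ring.
    apply threshold_orbit_bounded; try assumption. rewrite Rabs_Ropp; exact IH.
Qed.

(** A target moving at each step by less than the drift is followed within a
    bounded distance: the potential along the orbit controls the distance from
    below, and the potential along the mirrored orbit controls it from above. *)
Lemma steered_sum_follows beta t g x M N :
  1 < beta -> 1 / (beta + 1) < t -> (beta - 1) * (beta * t + 1) < 1 ->
  beta * t + 1 <= M -> (beta - 1) * M < 1 -> Rabs x <= M ->
  (forall n, (N <= n)%nat -> Rabs (g (S n) - g n) <= drift beta t) ->
  exists C, forall n, (N <= n)%nat -> Rabs (steered_sum beta t g x n - g n) <= C.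
Proof.
  intros hb ht htJ htM hM hx hg.
  assert (ht0 : 0 <= t)
    by (assert (0 < 1 / (beta + 1)) by (apply Rdiv_lt_0_compat; lra); lra).
  destruct (potential_bounded beta t M hb hM) as [B hB].
  pose proof (fun n => steered_orbit_bounded beta t g x M n
                         hb ht0 htM (Rlt_le _ _ hM) hx) as hy.
  set (D := fun n => steered_sum beta t g x n - g n).
  assert (hjump : forall n, (N <= n)%nat ->
            Rabs (D (S n) - D n) <= 1 + drift beta t).
  { intros n hn. unfold D. rewrite steered_sum_S.
    pose proof (hg n hn) as h. apply Rabs_le_between in h.
    apply Rabs_le_between. simpl.
    destruct (steering_digit_pm1 t (steered_orbit beta t g x n)
                (steered_sum beta t g x n - g n)); lra. }
  destruct (bounded_below_by_feedback D
              (fun n => potential beta t M (steered_orbit beta t g x n))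
              B (1 + drift beta t) N) as [C1 hC1].
  { intros n; apply hB, hy. }
  { intros n hn hneg. rewrite steered_orbit_S. unfold D in *.
    rewrite steered_sum_S. simpl. unfold steering_digit.
    destruct (Rlt_dec _ 0); [|lra].
    pose proof (potential_drift beta t M _ hb ht htJ hM (hy n)).
    pose proof (hg n hn) as h. apply Rabs_le_between in h. lra. }
  { intros n hn. pose proof (hjump n hn) as h.
    apply Rabs_le_between in h. lra. }
  destruct (bounded_below_by_feedback (fun n => - D n)
              (fun n => potential beta t M (- steered_orbit beta t g x n))
              B (1 + drift beta t) N) as [C2 hC2].
  { intros n; apply hB. rewrite Rabs_Ropp; apply hy. }
  { intros n hn hneg. rewrite steered_orbit_S. unfold D in *.
    rewrite steered_sum_S. simpl. unfold steering_digit.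
    destruct (Rlt_dec _ 0); [lra|].
    set (y := steered_orbit beta t g x n) in *.
    replace (- (beta * y - - threshold_digit t (- y)))
      with (beta * (- y) - threshold_digit t (- y)) by ring.
    assert (hy' : Rabs (- y) <= M) by (rewrite Rabs_Ropp; apply hy).
    pose proof (potential_drift beta t M _ hb ht htJ hM hy').
    pose proof (hg n hn) as h. apply Rabs_le_between in h. lra. }
  { intros n hn. pose proof (hjump n hn) as h.
    apply Rabs_le_between in h. lra. }
  exists (Rmax C1 C2). intros n hn.
  pose proof (hC1 n hn). pose proof (hC2 n hn) as h2. simpl in h2.
  pose proof (Rmax_l C1 C2). pose proof (Rmax_r C1 C2).
  apply Rabs_le_between. fold (D n). lra.
Qed.

(** * Passage to the limit *)

Lemma bounded_div_lim_0 (u v : nat -> R) (C : R) (N : nat) :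
  (forall n, (N <= n)%nat -> Rabs (u n) <= C) -> is_lim_seq v p_infty ->
  is_lim_seq (fun n => u n / v n) 0.
Proof.
  intros hu hv.
  assert (hi : is_lim_seq (fun n => / v n) 0)
    by (apply (is_lim_seq_inv v p_infty); [exact hv|discriminate]).
  apply is_lim_seq_abs_0.
  apply is_lim_seq_le_le_loc with (u := fun _ => 0)
    (w := fun n => C * Rabs (/ v n)).
  - exists N. intros n hn. split; [apply Rabs_pos|].
    unfold Rdiv. rewrite Rabs_mult.
    apply Rmult_le_compat_r; [apply Rabs_pos|auto].
  - apply is_lim_seq_const.
  - replace (Finite 0) with (Rbar_mult C 0) by (simpl; f_equal; ring).
    apply is_lim_seq_scal_l.
    replace (Finite 0) with (Rbar_abs 0) by (simpl; f_equal; apply Rabs_R0).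
    apply is_lim_seq_abs; exact hi.
Qed.

(** The remainder of the expansion after [n] digits is [y n / beta ^ n]. *)
Lemma expansion_of_bounded_orbit (beta M : R) (y e : nat -> R) :
  1 < beta -> (forall n, y (S n) = beta * y n - e (S n)) ->
  (forall n, Rabs (y n) <= M) ->
  is_series (fun k => e (S k) / beta ^ S k) (y O).
Proof.
  intros hb hrec hM.
  assert (hpow : forall n, beta ^ n <> 0) by (intros n; apply pow_nonzero; lra).
  assert (hsum : forall n, sum_n (fun k => e (S k) / beta ^ S k) n
                           = y O - y (S n) / beta ^ S n).
  { induction n as [|n IH].
    - rewrite sum_O, hrec. simpl. field; lra.
    - rewrite sum_Sn, IH, (hrec (S n)). unfold plus; simpl.
      field. split; [apply hpow|lra]. }
  change (is_lim_seq (sum_n (fun k => e (S k) / beta ^ S k)) (y O)).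
  apply (is_lim_seq_ext (fun n => y O - y (S n) / beta ^ S n)).
  { intros n; symmetry; apply hsum. }
  replace (y O) with (y O - 0) at 1 by ring.
  apply is_lim_seq_minus'; [apply is_lim_seq_const|].
  apply (is_lim_seq_incr_1 (fun n => y n / beta ^ n)).
  apply (bounded_div_lim_0 y (fun n => beta ^ n) M O); [intros; apply hM|].
  apply is_lim_seq_geom_p; exact hb.
Qed.

Lemma LimSup_seq_lt_eventually (u : nat -> R) (c : R) :
  Rbar_lt (LimSup_seq u) c -> exists N, forall n, (N <= n)%nat -> u n < c.
Proof.
  unfold LimSup_seq. destruct (ex_LimSup_seq u) as [l hl].
  intros h. destruct l as [l| |]; simpl in h, hl.
  - assert (h0 : 0 < c - l) by lra.
    destruct (hl (mkposreal _ h0)) as [_ [N hN]].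
    exists N. intros n hn. pose proof (hN n hn). simpl in *. lra.
  - contradiction.
  - exact (hl c).
Qed.

(* Stdlib reals + Coquelicot. A function on {1,2,3,...} is a [nat -> R] whose
   value at 0 is neither constrained nor used. *)
Theorem theorem2p5 :
  forall beta : R, 1 < beta < (1 + sqrt 5) / 2 ->
  exists c : R, 0 < c /\
  forall f : nat -> R,
    (forall n : nat, (1 <= n)%nat -> 0 < f n) ->
    (forall m n : nat, (1 <= m)%nat -> (m < n)%nat -> f m < f n) ->
    Rbar_lt (LimSup_seq (fun n : nat => f (n + 1)%nat - f n)) (Finite c) ->
    is_lim_seq f p_infty ->
  forall x : R, - (1 / (beta - 1)) < x < 1 / (beta - 1) ->
  exists eps : nat -> R,
    (forall i : nat, (1 <= i)%nat -> eps i = -1 \/ eps i = 1) /\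
    is_series (fun k : nat => eps (S k) / beta ^ (S k)) x /\
    is_lim_seq (fun n : nat => 1 / f n * sum_n_m eps 1 n) (Finite x).
Proof.
  intros beta hbeta.
  assert (hb : 1 < beta) by apply hbeta.
  destruct (threshold_exists beta hbeta) as [t [ht htJ]].
  assert (hd : 0 < drift beta t)
    by (apply Rdiv_lt_0_compat; [apply Rmult_lt_0_compat|]; lra).
  exists (drift beta t * (beta - 1)). split; [apply Rmult_lt_0_compat; lra|].
  intros f hpos hinc hsup hlim x hx.
  assert (hJ : (beta - 1) * (1 / (beta - 1)) = 1) by (field; lra).
  assert (hxJ : (beta - 1) * Rabs x < 1).
  { assert (Rabs x < 1 / (beta - 1)) by (apply Rabs_lt_between; lra). nra. }
  (* [x] itself may lie outside the interval that attracts the orbit. *)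
  set (M := Rmax (Rabs x) (beta * t + 1)).
  assert (hM : (beta - 1) * M < 1)
    by (unfold M, Rmax; destruct (Rle_dec (Rabs x) (beta * t + 1)); assumption).
  assert (hxM : Rabs x <= M) by apply Rmax_l.
  assert (htM : beta * t + 1 <= M) by apply Rmax_r.
  assert (ht0 : 0 <= t)
    by (assert (0 < 1 / (beta + 1)) by (apply Rdiv_lt_0_compat; lra); lra).
  destruct (LimSup_seq_lt_eventually _ _ hsup) as [N hN].
  set (g := fun n => x * f n).
  destruct (steered_sum_follows beta t g x M (S N)) as [C hC]; try assumption.
  { intros n hn. unfold g.
    replace (x * f (S n) - x * f n) with (x * (f (S n) - f n)) by ring.
    pose proof (hN n ltac:(lia)) as h. rewrite Nat.add_1_r in h.
    pose proof (hinc n (S n) ltac:(lia) ltac:(lia)) as h'.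
    rewrite Rabs_mult, (Rabs_right (f (S n) - f n)) by lra.
    pose proof (Rabs_pos x).
    apply Rle_trans with (Rabs x * (drift beta t * (beta - 1))).
    - apply Rmult_le_compat_l; lra.
    - replace (Rabs x * (drift beta t * (beta - 1)))
        with (drift beta t * ((beta - 1) * Rabs x)) by ring.
      nra. }
  exists (steered_digits beta t g x). split; [|split].
  - intros [|i] hi; [lia|]. apply steering_digit_pm1.
  - apply (expansion_of_bounded_orbit beta M (steered_orbit beta t g x));
      [exact hb|intros n; apply steered_orbit_S|].
    intros n; apply steered_orbit_bounded; lra.
  - apply (is_lim_seq_ext_loc
             (fun n => x + (steered_sum beta t g x n - g n) / f n)).
    + exists 1%nat. intros n hn. rewrite steered_sum_eq. unfold g.
      field. pose proof (hpos n hn). lra.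
    + replace (Finite x) with (Finite (x + 0)) by (f_equal; ring).
      apply is_lim_seq_plus'; [apply is_lim_seq_const|].
      exact (bounded_div_lim_0 _ f C (S N) hC hlim).
Qed.
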